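(* For any $\mu_0\in\operatorname{dom}(\ell)$, we have $$0\le Q_k(\mu_k)-Q_k(\mu_{k+1})\le\ell(\mu_k)-\ell(\mu_{k+1}),\qquad k\in\mathbb{N},$$ where $(\mu_k)$ are the iterates defined from $\mu_0$ by $\mu_{k+1}=\dfrac{\mu_k}{f}\sum_{\gamma\in\Gamma}\dfrac{\gamma}{\langle\mu_k,\gamma\rangle}$, and the surrogate function $Q_k:X_k\to\mathbb{R}$ is defined by $$Q_k(\mu):=\ell(\mu)+\sum_{\gamma\in\Gamma}D\big(\nu_\gamma(\mu_k)\,||\,\nu_\gamma(\mu)\big)$$ on the set $X_k:=\{\mu\in\mathcal{M}_+(K):\ \mu_{k+1}\ll\mu\ll\mu_k,\ \langle\mu,f\rangle=n\}$, $k\in\mathbb{N}$.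
   Context: $K\subset\mathbb{R}^p$ is compact. $\mathcal{C}(K)$ is the space of continuous functions on $K$; $\mathcal{M}(K)$ is its topological dual (Radon measures), endowed with its weak-$*$ topology, $\mathcal{M}_+(K)$ is the set of nonnegative measures, and $\langle\mu,g\rangle=\int_K g\,d\mu$ for $\mu\in\mathcal{M}(K)$, $g\in\mathcal{C}(K)$. For $g\in\mathcal{C}(K)$, $g\mu$ is the measure with density $g$ with respect to $\mu$; $\mu\ll\nu$ means that $\mu$ is absolutely continuous with respect to $\nu$. The functions $a_1,\dots,a_m$ satisfy $a_i\in\mathcal{C}(K)$, $a_i\ge0$. The operator $A:\mathcal{M}(K)\to\mathbb{R}^m$ is $(A\mu)_i=\langle\mu,a_i\rangle$, $i=1,\dots,m$; its adjoint $A^*:\mathbb{R}^m\to\mathcal{C}(K)$ is $A^*\lambda=\sum_{i=1}^m\lambda_i a_i$, and $\boldsymbol{1}=(1,\dots,1)\in\mathbb{R}^m$. For each $t\in[0,1]$, $\mathcal{W}_t:\mathcal{M}(K)\to\mathcal{M}(K)$ is a known linear operator, continuous in the weak-$*$ topology, with adjoint $\mathcal{W}_t^*:\mathcal{C}(K)\to\mathcal{C}(K)$ given by $\langle\mathcal{W}_t\mu,g\rangle=\langle\mu,\mathcal{W}_t^*g\rangle$. Standing assumptions: (nonnegativity preservation) $\mu\ge0\Rightarrow\mathcal{W}_t\mu\ge0$ for all $t\in[0,1]$; (integrability) $\int_{[0,1]\times K}\mathcal{W}_t^*1<+\infty$, where $1$ denotes the constant function in $\mathcal{C}(K)$; (positivity)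 the function $f:=\int_0^1\mathcal{W}_t^*A^*\boldsymbol{1}\,dt$, which the integrability condition allows one to define, satisfies $f(x)\ge c$ for all $x\in K$, for some constant $c>0$. Data: for each $i\in\{1,\dots,m\}$, a number $n_i$ of detections and times $t^i_j\in[0,1]$, $j=1,\dots,n_i$; $n=\sum_{i=1}^m n_i$. $\Gamma$ is the collection of the $n$ continuous functions $\mathcal{W}_{t^i_j}^*a_i$, $i=1,\dots,m$, $j=1,\dots,n_i$. The function $\ell$ is defined on $\mathcal{M}_+(K)$ by $\ell(\mu)=\langle\mu,f\rangle-\sum_{\gamma\in\Gamma}\log(\langle\mu,\gamma\rangle)$ for $\mu\in\operatorname{dom}(\ell):=\{\mu\in\mathcal{M}_+(K):\langle\mu,\gamma\rangle>0,\ \gamma\in\Gamma\}$, and $\ell(\mu)=+\infty$ otherwise. The iterates are well defined since $\mu_k\in\operatorname{dom}(\ell)$ implies $\mu_{k+1}\in\operatorname{dom}(\ell)$, and they satisfy $\langle\mu_k,f\rangle=n$ for all $k\ge1$. For a nonnegative function $\gamma\in\mathcal{C}(K)$ and a measure $\mu\in\mathcal{M}_+(K)$, $\nu_\gamma(\mu):=\dfrac{\gamma\mu}{\langle\mu,\gamma\rangle}$, a probability measure on $K$. The Kullback–Leibler divergence of two probability measures $\mu\ll\nu$ on $K$ is $D(\mu||\nu):=\int_K\log\big(\frac{d\mu}{d\nu}\big)\,d\mu$, where $\frac{d\mu}{d\nu}$ is the Radon–Nikodym derivative.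
   Formalization: The function f is additionally assumed to be defined at every point of K and continuous on K, which the integrability condition alone does not give but the pairing of measures with f requires; Q_k is allowed the value +∞. *)

(* Defs.v *)
From HB Require Import structures.
From mathcomp Require Import all_boot all_order all_algebra.
From mathcomp Require Import all_classical all_reals all_analysis.

Set Implicit Arguments.
Unset Strict Implicit.
Unset Printing Implicit Defensive.

Import Order.TTheory GRing.Theory Num.Theory.
Import numFieldNormedType.Exports.

Local Open Scope classical_set_scope.
Local Open Scope ring_scope.

Definition borel (R : realType) (p : nat) :=
  g_sigma_algebraType (@open 'rV[R]_p).

(* Borel measures on K are represented by Borel measures on R^p that vanish
   outside K; this also covers an empty K, for which no measurableType (they
   are all pointed) is available. *)
Definition concentrated_on (R : realType) (p : nat) (K : set 'rV[R]_p)
    (nu : set (borel R p) -> \bar R) : Prop :=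
  forall A : set (borel R p), measurable A -> A `&` K = set0 -> nu A = 0%E.

(* C(K): only the values on K of such a function are meaningful. *)
Definition CK (R : realType) (p : nat) (K : set 'rV[R]_p) :=
  continuousType (subspace K) R.

(* M(K): on a compact subset of R^p, the Radon measures are the finite signed
   Borel measures. *)
Record MK (R : realType) (p : nat) (K : set 'rV[R]_p) := MkMK {
  MK_charge :> {charge set (borel R p) -> \bar R} ;
  MK_concentrated : concentrated_on K MK_charge }.

Section charge_pairing.
Context (R : realType) (p : nat) (K : set 'rV[R]_p).
Variables (nu : {charge set (borel R p) -> \bar R}) (g : 'rV[R]_p -> R).

Let P := cid (Hahn_decomposition nu).
Let N := cid (svalP P).

Definition charge_pairing : R :=
  \int[jordan_pos (svalP N)]_(x in K) g x
  - \int[jordan_neg (svalP N)]_(x in K) g x.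

End charge_pairing.

Definition pairingMK (R : realType) (p : nat) (K : set 'rV[R]_p)
    (mu : MK K) (g : CK K) : R := charge_pairing K mu g.

HB.instance Definition _ (R : realType) (p : nat) (K : set 'rV[R]_p) :=
  gen_eqMixin (MK K).
HB.instance Definition _ (R : realType) (p : nat) (K : set 'rV[R]_p) :=
  gen_choiceMixin (MK K).

(* The weak-* topology: pointwise convergence of the pairings with C(K). *)
HB.instance Definition _ (R : realType) (p : nat) (K : set 'rV[R]_p) :=
  Topological.copy (MK K)
    (initial_topology (@pairingMK R p K : MK K -> {ptws CK K -> R})).

(* Stated by means of the values on Borel sets, because set functions carry
   irrelevant values on the other sets. *)
Definition linear_op (R : realType) (p : nat) (K : set 'rV[R]_p)
    (V : MK K -> MK K) : Prop :=
  forall (r : R) (mu nu la : MK K),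
    (forall A, measurable A -> la A = (r%:E * mu A + nu A)%E) ->
    forall A, measurable A -> V la A = (r%:E * V mu A + V nu A)%E.

Definition nonneg_charge (R : realType) (p : nat)
    (nu : set (borel R p) -> \bar R) : Prop :=
  forall A : set (borel R p), measurable A -> (0 <= nu A)%E.

Definition nonneg_preserving (R : realType) (p : nat) (K : set 'rV[R]_p)
    (V : MK K -> MK K) : Prop :=
  forall mu : MK K, nonneg_charge mu -> nonneg_charge (V mu).

Definition adjoint_ops (R : realType) (p : nat) (K : set 'rV[R]_p)
    (V : MK K -> MK K) (Vadj : CK K -> CK K) : Prop :=
  forall (mu : MK K) (g : CK K), pairingMK (V mu) g = pairingMK mu (Vadj g).

Definition is_lebesgue (R : realType) (p : nat)
    (la : set (borel R p) -> \bar R) : Prop :=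
  forall u v : 'rV[R]_p, (forall i, u ord0 i <= v ord0 i) ->
    la [set x | forall i, u ord0 i <= x ord0 i <= v ord0 i] =
    (\prod_i (v ord0 i - u ord0 i))%:E.

Lemma Aadj_continuous (R : realType) (p : nat) (K : set 'rV[R]_p) (m : nat)
    (a : 'I_m -> CK K) (la : 'I_m -> R) :
  continuous (fun x : subspace K => \sum_i la i * a i x).
Proof.
move=> x; apply: (@cvg_big _ _ +%R) => // [|i _].
  exact: add_continuous.
by apply: cvgM; [exact: cvg_cst|exact: cts_fun].
Qed.

Definition Aadj (R : realType) (p : nat) (K : set 'rV[R]_p) (m : nat)
    (a : 'I_m -> CK K) (la : 'I_m -> R) : CK K :=
  mkcts (@Aadj_continuous R p K m a la).

Definition one_CK (R : realType) (p : nat) (K : set 'rV[R]_p) : CK K :=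
  @cst (subspace K) R 1.

(* f := \int_0^1 W_t^* A^* 1 dt, where 1 = (1, ..., 1) *)
Definition sensitivity (R : realType) (p : nat) (K : set 'rV[R]_p) (m : nat)
    (a : 'I_m -> CK K) (Wadj : R -> CK K -> CK K) (x : 'rV[R]_p) : R :=
  \int[@lebesgue_measure R]_(t in `[0, 1]) Wadj t (Aadj a (fun=> 1)) x.

(* The n functions of Gamma are indexed by the pairs (i, j), j < n_i; they need
   not be distinct. *)
Definition detection (m : nat) (nd : 'I_m -> nat) := {i : 'I_m & 'I_(nd i)}.

Definition Gamma (R : realType) (p : nat) (K : set 'rV[R]_p) (m : nat)
    (a : 'I_m -> CK K) (Wadj : R -> CK K -> CK K) (nd : 'I_m -> nat)
    (td : forall i, 'I_(nd i) -> R) (e : detection nd) : CK K :=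
  Wadj (td (tag e) (tagged e)) (a (tag e)).

Definition pairing (R : realType) (p : nat) (K : set 'rV[R]_p)
    (mu : {finite_measure set (borel R p) -> \bar R}) (g : 'rV[R]_p -> R) : R :=
  \int[mu]_(x in K) g x.

Definition is_density (R : realType) (p : nat) (K : set 'rV[R]_p)
    (mu : {finite_measure set (borel R p) -> \bar R}) (g : 'rV[R]_p -> R) :=
  [/\ @measurable _ (borel R p) K, forall x, K x -> 0 <= g x &
      mu.-integrable K (EFin \o g)].

(* The measure g mu, for a nonnegative g that is mu-integrable on K; the null
   measure is a default value for the other functions g. *)
Definition dens (R : realType) (p : nat) (K : set 'rV[R]_p)
    (g : 'rV[R]_p -> R) (mu : {finite_measure set (borel R p) -> \bar R})
    (A : set (borel R p)) : \bar R :=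
  if pselect (is_density K mu g) then (\int[mu]_(x in A `&` K) (g x)%:E)%E
  else 0%E.

Section dens_measure.
Context (R : realType) (p : nat) (K : set 'rV[R]_p) (g : 'rV[R]_p -> R).
Variable mu : {finite_measure set (borel R p) -> \bar R}.

Local Notation dgmu := (dens K g mu).

Let dens0 : dgmu set0 = 0%E.
Proof. by rewrite /dens; case: pselect => //= _; rewrite set0I integral_set0. Qed.

Let dens_ge0 A : (0 <= dgmu A)%E.
Proof.
rewrite /dens; case: pselect => //= -[_ g0 _].
by apply: integral_ge0 => x [_ Kx]; rewrite lee_fin g0.
Qed.

Let dens_sigma_additive : semi_sigma_additive dgmu.
Proof.
move=> F mF tF mUF; rewrite /dens; case: pselect => /= [[mK g0 ig]|_]; last first.
  by apply: cvg_near_cst; near=> n; rewrite big1.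
have mFK n : measurable (F n `&` K) by exact: measurableI.
rewrite setI_bigcupl ge0_integral_bigcup//.
- by apply: is_cvg_nneseries => n _ _; apply: integral_ge0 => x [_ Kx];
    rewrite lee_fin g0.
- apply: measurable_funS (measurable_int _ ig) => //.
  by move=> x [n _ []].
- by move=> x [n _ [_ Kx]]; rewrite lee_fin g0.
- exact: trivIset_setIr.
Unshelve. all: by end_near. Qed.

HB.instance Definition _ := isMeasure.Build _ _ _ dgmu
  dens0 dens_ge0 dens_sigma_additive.

Let dens_fin : fin_num_fun dgmu.
Proof.
move=> A mA; rewrite /dens; case: pselect => //= -[mK g0 ig].
apply: integrable_fin_num; first exact: measurableI.
by apply: integrableS ig => //; exact: measurableI.
Qed.

HB.instance Definition _ := @Measure_isFinite.Build _ _ _ dgmu dens_fin.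

End dens_measure.

Definition nu_ (R : realType) (p : nat) (K : set 'rV[R]_p)
    (g : 'rV[R]_p -> R) (mu : {finite_measure set (borel R p) -> \bar R}) :
    {finite_measure set (borel R p) -> \bar R} :=
  dens K (fun x => g x / pairing K mu g) mu.

(* D(mu || nu), with the usual value +oo when mu is not absolutely continuous
   with respect to nu. The measures it is applied to vanish outside K, so that
   integrating over R^p or over K is the same. *)
Definition KL d (T : measurableType d) (R : realType)
    (mu nu : {finite_measure set T -> \bar R}) : \bar R :=
  if pselect (mu `<< nu) then
    (\int[mu]_x lne (Radon_Nikodym (charge_of_finite_measure mu) nu x))%E
  else +oo%E.

Section em.
Context (R : realType) (p : nat) (K : set 'rV[R]_p) (I : finType).
Variables (f : 'rV[R]_p -> R) (gam : I -> 'rV[R]_p -> R).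

Local Notation Mfin := {finite_measure set (borel R p) -> \bar R}.

Definition dom_ell : set Mfin :=
  [set mu : Mfin | concentrated_on K mu /\ forall e, 0 < pairing K mu (gam e)].

Definition ell (mu : Mfin) : \bar R :=
  if pselect (dom_ell mu) then
    (pairing K mu f - \sum_e ln (pairing K mu (gam e)))%:E
  else +oo%E.

Definition em_step (mu : Mfin) : Mfin :=
  dens K (fun x => (f x)^-1 * \sum_e gam e x / pairing K mu (gam e)) mu.

Definition em_iter (mu0 : Mfin) (k : nat) : Mfin := iter k em_step mu0.

(* X_k and Q_k, for muk = mu_k. The formula of Q_k is given for all measures: it
   is needed at mu_0, whose pairing with f need not be n. It is extended-real
   valued since its divergence terms may be infinite, even on X_k. *)
Definition X_ (n : nat) (muk : Mfin) : set Mfin :=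
  [set mu : Mfin | [/\ concentrated_on K mu,
    em_step muk `<< mu, mu `<< muk & pairing K mu f = n%:R]].

Definition Q_ (muk mu : Mfin) : \bar R :=
  (ell mu + \sum_e KL (nu_ K (gam e) muk) (nu_ K (gam e) mu))%E.

End em.

(* Main.v *)
Require Import Defs.
From mathcomp Require Import all_boot all_order all_algebra.
From mathcomp Require Import all_classical all_reals all_analysis.
From mathcomp Require Import measurable_realfun ring lra.

(* Let h := f^-1 \sum_g g / <mu, g> be the density of mu' := mu_{k+1} with
   respect to mu := mu_k. For each g in Gamma both nu_g(mu) and nu_g(mu') have
   densities with respect to mu, so their divergence is
     log <mu', g> - log <mu, g> - \int (g / <mu, g>) log h dmu.
   Summing over Gamma, the terms log <mu', g> cancel those of ell(mu') and the
   functions g / <mu, g> add up to f h. Since n = <mu', f> = \int f h dmu,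
     Q_k(mu) - Q_k(mu') = \int f (1 - h + h log h) dmu >= 0.
   The upper bound is the nonnegativity of the divergences. All the integrands
   are bounded because t log t is bounded on bounded sets and
   0 <= g / <mu, g> <= f h. That the functions g = W_t^* a_i are nonnegative is
   seen by pairing them with Dirac masses. *)

Set Implicit Arguments.
Unset Strict Implicit.
Unset Printing Implicit Defensive.

Import Order.TTheory GRing.Theory Num.Theory.
Import numFieldNormedType.Exports.

Local Open Scope classical_set_scope.
Local Open Scope ring_scope.

(** * Measurability and inequalities for logarithm and inverse *)

Lemma measurable_lne (R : realType) : measurable_fun [set: \bar R] (@lne R).
Proof.
apply: (measurability _ (ErealGenOInfty.measurableE R)) => _ [_ [r ->] <-].
rewrite setTI (_ : _ @^-1` _ = [set` `](expR r)%:E, +oo[%E]).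
  exact: emeasurable_itv.
apply/seteqP; split => -[x| |]//=; rewrite !in_itv/= !andbT ?ltry//.
  case: ifPn => [|/negP/negP]; first by rewrite ltNge leNye.
  by rewrite -ltNge !lte_fin => x0 rx; rewrite -ltr_ln ?posrE ?expR_gt0// expRK.
case: ifPn => [x0|/negP/negP].
  by rewrite lte_fin => /(lt_trans (expR_gt0 r)); rewrite ltNge x0.
by rewrite -ltNge !lte_fin => x0 rx; rewrite -(expRK r) ltr_ln ?posrE ?expR_gt0.
Qed.

Lemma measurable_inv (R : realType) : measurable_fun [set: R] (@GRing.inv R).
Proof.
(* Squaring makes the base nonnegative, so that the power of exponent -1 is the true inverse; at [0]
   both sides are [0]. *)
rewrite (_ : GRing.inv = fun x : R => x * (x * x) `^ (-1)); last first.
  apply/funext => x; rewrite -expr2 powR_inv1 ?sqr_ge0//.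
  have [->|x0] := eqVneq x 0; first by rewrite invr0 mul0r.
  by field.
apply: measurable_funM => //.
apply: (measurableT_comp (@measurable_powR R (-1))).
exact: measurable_funM.
Qed.

(** This is [ln y <= y - 1] at [y = v / u], multiplied by [u]. It serves twice: with [v := 1] for
    [1 - h + h ln h >= 0], and with two densities for the nonnegativity of a divergence. *)
Lemma ln_div_ge (R : realType) (u v : R) : 0 <= u -> 0 <= v ->
  (v = 0 -> u = 0) -> u - v <= u * ln (u / v).
Proof.
rewrite le_eqVlt => /predU1P[<-|u0].
  by move=> v0 _; rewrite mul0r sub0r oppr_le0.
rewrite le_eqVlt => /predU1P[<- /(_ erefl) u00|v0 _].
  by rewrite u00 ltxx in u0.
have -> : u - v = u * (1 - v / u) by field; rewrite gt_eqF.
rewrite ler_pM2l//.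
rewrite -(invf_div v u) lnV ?posrE ?divr_gt0//.
have := @le_ln1Dx R (v / u - 1).
have : 0 < v / u by rewrite divr_gt0.
rewrite addrCA subrr addr0; lra.
Qed.

(** * Measures given by a density, and their divergence *)

Section density.
Context d (T : measurableType d) (R : realType).
Variables (mu nu : {finite_measure set T -> \bar R}) (g : T -> R).
Hypothesis g0 : forall x, 0 <= g x.
Hypothesis mg : measurable_fun setT g.
Hypothesis nuE : forall A, measurable A ->
  nu A = (\int[mu]_(x in A) (g x)%:E)%E.

Lemma density_dominates : nu `<< mu.
Proof.
apply/null_content_dominatesP => A mA muA.
rewrite nuE//; apply: null_set_integral => //.
by apply/measurable_EFinP; exact: measurable_funTS.
Qed.

(** [g] and the Radon-Nikodym derivative have the same integral over every measurable set, hence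
    agree [mu]-almost everywhere, and the change of variables formula for the latter carries over to
    [g]. *)
Lemma ge0_integral_density (D : set T) (F : T -> \bar R) : measurable D ->
  measurable_fun D F -> (forall x, (0 <= F x)%E) ->
  (\int[nu]_(x in D) F x = \int[mu]_(x in D) (F x * (g x)%:E))%E.
Proof.
move=> mD mF F0; have numu := density_dominates.
have mgE : measurable_fun setT (EFin \o g) by exact/measurable_EFinP.
rewrite -(Radon_Nikodym_SigmaFinite.change_of_variables numu)//.
have mRN := measurable_int _ (Radon_Nikodym_SigmaFinite.f_integrable numu).
apply: ae_eq_integral => //.
- by apply: emeasurable_funM => //; exact: measurable_funTS.
- by apply: emeasurable_funM => //; exact: measurable_funTS.
- apply: ae_eqe_mul2l; apply: integral_ae_eq => //.
  + apply: integrableS (Radon_Nikodym_SigmaFinite.f_integrable numu) => //.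
  + exact: measurable_funTS.
  + by move=> E _ mE; rewrite -nuE// -Radon_Nikodym_SigmaFinite.f_integral.
Qed.

(** Multiplication by [g >= 0] commutes with positive and negative parts, so both sides are the same
    difference of extended reals, even when it is infinite. *)
Lemma integral_density (D : set T) (F : T -> \bar R) : measurable D ->
  measurable_fun D F ->
  (\int[nu]_(x in D) F x = \int[mu]_(x in D) (F x * (g x)%:E))%E.
Proof.
move=> mD mF; rewrite integralE [RHS]integralE; congr (_ - _)%E.
  rewrite ge0_integral_density//; last exact: measurable_funepos.
  apply: eq_integral => x _.
  by rewrite /= !funeposE maxe_pMl ?lee_fin// mul0e.
rewrite ge0_integral_density//; last exact: measurable_funeneg.
apply: eq_integral => x _.
by rewrite /= !funenegE maxe_pMl ?lee_fin// mul0e mulNe.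
Qed.

Lemma KL_density : KL nu mu = (\int[nu]_x lne (g x)%:E)%E.
Proof.
have numu := density_dominates.
rewrite /KL; case: pselect => // numu0; rewrite [LHS]/= {numu0}.
pose nuc := charge_of_finite_measure nu.
apply: ae_eq_integral => //.
- apply: measurableT_comp; first exact: measurable_lne.
  exact: (measurable_int _ (Radon_Nikodym_integrable (nu := nuc) numu)).
- by apply: (measurableT_comp (@measurable_lne R)); exact/measurable_EFinP.
(* The derivative equals [g] almost everywhere for [mu], whereas the integral is against [nu];
   domination transfers the null sets. *)
- apply: (ae_eq_comp (@lne R)); apply: (null_dominates_ae_eq _ numu) => //.
  apply: integral_ae_eq => //; first exact: Radon_Nikodym_integrable.
    exact/measurable_EFinP.
  by move=> E _ mE; rewrite -nuE// -Radon_Nikodym_integral.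
Qed.

End density.

(** The quotient [u / v] is a density of [nu1] with respect to [nu2]: where [v] vanishes so does
    [u], and the default value of the division is harmless. The integral against [nu1] is then
    brought back to [mu]. *)
Lemma KL_common_density d (T : measurableType d) (R : realType)
    (mu nu1 nu2 : {finite_measure set T -> \bar R}) (u v : T -> R) :
  measurable_fun setT u -> measurable_fun setT v ->
  (forall x, 0 <= u x) -> (forall x, 0 <= v x) ->
  (forall x, v x = 0 -> u x = 0) ->
  (forall A, measurable A -> nu1 A = (\int[mu]_(x in A) (u x)%:E)%E) ->
  (forall A, measurable A -> nu2 A = (\int[mu]_(x in A) (v x)%:E)%E) ->
  KL nu1 nu2 = (\int[mu]_x (u x * ln (u x / v x))%:E)%E.
Proof.
move=> mu_ mv u0 v0 vu nu1E nu2E.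
have mphi : measurable_fun setT (fun x => u x / v x).
  apply: measurable_funM => //.
  exact: (measurableT_comp (@measurable_inv R)).
rewrite (@KL_density _ _ _ nu2 nu1 (fun x => u x / v x))//; last first.
  move=> A mA; rewrite (@integral_density _ _ _ mu nu2 v)//; last first.
    by apply/measurable_EFinP; exact: measurable_funTS.
  rewrite nu1E//; apply: eq_integral => x _; rewrite -EFinM.
  by have [/[dup]/vu-> ->|v0'] := eqVneq (v x) 0; rewrite ?mulr0// divfK.
rewrite (@integral_density _ _ _ mu nu1 u)//; last first.
  by apply: (measurableT_comp (@measurable_lne R)); exact/measurable_EFinP.
(* Where [u] vanishes [lne] is [-oo] while [ln] is a real default value; the factor [u x = 0]
   cancels both. *)
apply: eq_integral => x _; have [u0'|u0'] := eqVneq (u x) 0.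
  by rewrite u0' mule0 !mul0r.
have v0' : v x != 0 by apply: contra_neq u0'; exact: vu.
have uv : 0 < u x / v x by rewrite divr_gt0// lt_def ?u0 ?v0 ?u0' ?v0'.
by rewrite lne_EFin// -EFinM mulrC.
Qed.

Lemma KL_common_density_on d (T : measurableType d) (R : realType) (D : set T)
    (mu nu1 nu2 : {finite_measure set T -> \bar R}) (u v : T -> R) :
  measurable D -> measurable_fun D u -> measurable_fun D v ->
  (forall x, D x -> 0 <= u x) -> (forall x, D x -> 0 <= v x) ->
  (forall x, D x -> v x = 0 -> u x = 0) ->
  (forall A, measurable A -> nu1 A = (\int[mu]_(x in A `&` D) (u x)%:E)%E) ->
  (forall A, measurable A -> nu2 A = (\int[mu]_(x in A `&` D) (v x)%:E)%E) ->
  KL nu1 nu2 = (\int[mu]_(x in D) (u x * ln (u x / v x))%:E)%E.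
Proof.
move=> mD mu_ mv u0 v0 vu nu1E nu2E.
have patch_ge0 (g : T -> R) : (forall x, D x -> 0 <= g x) ->
    forall x, 0 <= (g \_ D) x.
  by move=> g0 x; rewrite patchE; case: ifPn => // /set_mem; exact: g0.
have patch_int (g : T -> R) A : (\int[mu]_(x in A `&` D) (g x)%:E =
    \int[mu]_(x in A) ((g \_ D) x)%:E)%E.
  by rewrite integral_mkcondr; apply: eq_integral => x _; rewrite restrict_EFin.
(* Extension by [0] outside [D] keeps the signs and the inclusion of zeros, which reduces the claim
   to the whole space. *)
rewrite (@KL_common_density _ _ _ mu _ _ (u \_ D) (v \_ D)).
- rewrite [RHS]integral_mkcond; apply: eq_integral => x _; rewrite !patchE.
  by case: ifPn => //; rewrite mul0r.
- exact/(measurable_restrictT _ mD).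
- exact/(measurable_restrictT _ mD).
- exact: patch_ge0.
- exact: patch_ge0.
- by move=> x; rewrite !patchE; case: ifPn => // /set_mem; exact: vu.
- by move=> A mA; rewrite nu1E.
- by move=> A mA; rewrite nu2E.
Qed.

(** * Bounded measurable functions and their integrals *)

Lemma normr_mul_ln (R : realType) (t : R) : 0 <= t -> `|t * ln t| <= 1 + t ^+ 2.
Proof.
move=> t0; rewrite ler_norml; apply/andP; split.
  (* The lower bound is [ln_div_ge] with [v := 1]; the upper bound below comes from [ln t < t]. *)
  have : t - 1 <= t * ln t.
    rewrite -{3}(divr1 t); apply: ln_div_ge => // /eqP.
    by rewrite oner_eq0.
  have := sqr_ge0 t.
  lra.
move: t0; rewrite le_eqVlt => /predU1P[<-|t0].
  by rewrite mul0r expr0n addr0.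
by rewrite expr2 ler_wpDl// ler_pM2l// ltW// ln_sublinear.
Qed.

(** A class stable under sums and products whose members are integrable for every finite measure:
    integrability questions about the EM step reduce to these closure rules. *)
Definition bounded_measurable d (T : measurableType d) (R : realType)
    (D : set T) (g : T -> R) :=
  measurable_fun D g /\ exists M, forall x, D x -> `|g x| <= M.

Section bounded_measurable.
Context d (T : measurableType d) (R : realType) (D : set T).
Implicit Types g : T -> R.

Lemma bounded_measurable_cst (r : R) : bounded_measurable D (cst r).
Proof. by split; [exact: measurable_cst|exists `|r|]. Qed.

Lemma bounded_measurableD g1 g2 : bounded_measurable D g1 ->
  bounded_measurable D g2 -> bounded_measurable D (fun x => g1 x + g2 x).
Proof.
move=> [m1 [M1 b1]] [m2 [M2 b2]]; split; first exact: measurable_funD.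
exists (M1 + M2) => x Dx; apply: (le_trans (ler_normD _ _)).
by rewrite lerD ?b1 ?b2.
Qed.

Lemma bounded_measurableB g1 g2 : bounded_measurable D g1 ->
  bounded_measurable D g2 -> bounded_measurable D (fun x => g1 x - g2 x).
Proof.
move=> [m1 [M1 b1]] [m2 [M2 b2]]; split; first exact: measurable_funB.
exists (M1 + M2) => x Dx; apply: (le_trans (ler_normB _ _)).
by rewrite lerD ?b1 ?b2.
Qed.

Lemma bounded_measurableM g1 g2 : bounded_measurable D g1 ->
  bounded_measurable D g2 -> bounded_measurable D (fun x => g1 x * g2 x).
Proof.
move=> [m1 [M1 b1]] [m2 [M2 b2]]; split; first exact: measurable_funM.
by exists (M1 * M2) => x Dx; rewrite normrM ler_pM ?b1 ?b2.
Qed.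

Lemma bounded_measurable_sum (I : Type) (s : seq I) (G : I -> T -> R) :
  (forall i, bounded_measurable D (G i)) ->
  bounded_measurable D (fun x => \sum_(i <- s) G i x).
Proof.
move=> bG; elim: s => [|i s ih].
  by under eq_fun do rewrite big_nil; exact: bounded_measurable_cst.
by under eq_fun do rewrite big_cons; exact: bounded_measurableD.
Qed.

Variable mu : {finite_measure set T -> \bar R}.
Hypothesis mD : measurable D.

Lemma bounded_measurable_integrable g :
  bounded_measurable D g -> mu.-integrable D (EFin \o g).
Proof.
move=> [mg [M gM]]; apply: measurable_bounded_integrable => //.
  by rewrite ltey_eq fin_num_measure.
exists M; split=> [|N MN x Dx]; first exact: num_real.
exact: le_trans (gM _ Dx) (ltW MN).
Qed.

Lemma integral_bounded_measurable g : bounded_measurable D g ->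
  (\int[mu]_(x in D) (g x)%:E = (\int[mu]_(x in D) g x)%:E)%E.
Proof.
move=> bg; rewrite fineK// integrable_fin_num//.
exact: bounded_measurable_integrable.
Qed.

Lemma Rintegral_bounded_measurable_sum (I : Type) (s : seq I)
    (G : I -> T -> R) :
  (forall i, bounded_measurable D (G i)) ->
  \int[mu]_(x in D) (\sum_(i <- s) G i x) =
  \sum_(i <- s) \int[mu]_(x in D) G i x.
Proof.
move=> bG; elim: s => [|i s ih].
  under eq_Rintegral do rewrite big_nil.
  by rewrite big_nil Rintegral_cst// mul0r.
under eq_Rintegral do rewrite big_cons.
rewrite RintegralD// ?ih ?big_cons//; apply: bounded_measurable_integrable.
  exact: bG.
exact: bounded_measurable_sum.
Qed.

(** By contraposition: a nonnegative [v] of zero integral vanishes almost everywhere, hence so does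
    [u]. This keeps the pairings with Gamma positive along the iteration. *)
Lemma Rintegral_gt0_support (u v : T -> R) :
  bounded_measurable D u -> bounded_measurable D v ->
  (forall x, D x -> 0 <= u x) -> (forall x, D x -> 0 <= v x) ->
  (forall x, D x -> v x = 0 -> u x = 0) ->
  0 < \int[mu]_(x in D) u x -> 0 < \int[mu]_(x in D) v x.
Proof.
move=> bu bv u0 v0 vu; rewrite !lt_def !Rintegral_ge0// !andbT.
have absE (g : T -> R) : (forall x, D x -> 0 <= g x) ->
    (\int[mu]_(x in D) (g x)%:E = \int[mu]_(x in D) `|(EFin \o g) x|)%E.
  by move=> g0; apply: eq_integral => x /set_mem Dx; rewrite /= ger0_norm ?g0.
have mE (g : T -> R) : bounded_measurable D g -> measurable_fun D (EFin \o g).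
  by move=> [mg _]; exact/measurable_EFinP.
apply: contra_neq => iv0.
have /(ae_eq_integral_abs mu mD (mE _ bv)) ae_v0 :
    (\int[mu]_(x in D) `|(EFin \o v) x| = 0)%E.
  by rewrite -absE// integral_bounded_measurable// iv0.
rewrite /Rintegral absE//; apply: (congr1 fine (y := 0%E)).
apply/(ae_eq_integral_abs mu mD (mE _ bu)).
by apply: filterS ae_v0 => x vx Dx; rewrite /= (vu _ Dx)//; have [] := vx Dx.
Qed.

End bounded_measurable.

(** * The measures [dens K g mu] *)

Section dens_theory.
Context (R : realType) (p : nat) (K : set 'rV[R]_p).
Hypothesis mK : @measurable _ (borel R p) K.
Local Notation Mfin := {finite_measure set (borel R p) -> \bar R}.
Implicit Types (mu : Mfin) (g u : borel R p -> R).

Lemma bounded_is_density mu g : bounded_measurable (K : set (borel R p)) g ->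
  (forall x, K x -> 0 <= g x) -> is_density K mu g.
Proof. by move=> bg g0; split => //; exact: bounded_measurable_integrable. Qed.

Lemma dens_concentrated mu g : concentrated_on K (dens K g mu).
Proof.
move=> A mA AK; rewrite /dens; case: pselect => //= _.
by rewrite AK integral_set0.
Qed.

Lemma dens_dominates mu g : dens K g mu `<< mu.
Proof.
apply/null_content_dominatesP => A mA muA; rewrite /dens.
case: pselect => //= -[_ g0 ig]; apply: null_set_integral => //.
- exact: measurableI.
- by apply: measurable_funS (measurable_int _ ig).
- by apply: (subset_measure0 _ mA _ muA) => //; exact: measurableI.
Qed.

Lemma densE mu g A : is_density K mu g ->
  dens K g mu A = (\int[mu]_(x in A `&` K) (g x)%:E)%E.
Proof. by rewrite /dens; case: pselect. Qed.

Lemma dens_restrictE mu g A : is_density K mu g ->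
  dens K g mu A = (\int[mu]_(x in A) ((g \_ K) x)%:E)%E.
Proof.
move=> dg; rewrite densE// integral_mkcondr.
by apply: eq_integral => x _; rewrite restrict_EFin.
Qed.

Lemma integral_dens mu g (F : borel R p -> \bar R) (D : set (borel R p)) :
  is_density K mu g ->
  measurable D -> D `<=` K -> measurable_fun D F ->
  (\int[dens K g mu]_(x in D) F x = \int[mu]_(x in D) (F x * (g x)%:E))%E.
Proof.
move=> dg mD DK mF; have [_ g0 ig] := dg.
have mgK : measurable_fun (setT : set (borel R p)) (g \_ K).
  apply/(measurable_restrictT _ mK).
  by apply/measurable_EFinP; exact: (measurable_int mu ig).
have gK0 x : 0 <= (g \_ K) x.
  by rewrite patchE; case: ifPn => // /set_mem; exact: g0.
rewrite (@integral_density _ _ _ mu _ _ gK0 mgK)//; last first.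
  by move=> A mA; exact: dens_restrictE.
by apply: eq_integral => x /set_mem /DK Kx; rewrite patchE mem_set.
Qed.

Lemma pairing_dens mu g u : is_density K mu g ->
  measurable_fun (K : set (borel R p)) u ->
  pairing K (dens K g mu) u = \int[mu]_(x in K) (u x * g x).
Proof.
move=> dg mu_; rewrite /pairing /Rintegral integral_dens//.
exact/measurable_EFinP.
Qed.

End dens_theory.

(** * One EM step, from [mu] to [mu'] *)

Section em_theory.
Context (R : realType) (p : nat) (K : set 'rV[R]_p) (I : finType).
Local Notation Mfin := {finite_measure set (borel R p) -> \bar R}.
Local Notation bm g := (bounded_measurable (K : set (borel R p)) g).
Variables (f : 'rV[R]_p -> R) (gam : I -> 'rV[R]_p -> R) (c : R) (mu : Mfin).
Hypothesis mK : @measurable _ (borel R p) K.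
Hypothesis bf : bm f.
Hypotheses (c0 : 0 < c) (cf : forall x, K x -> c <= f x).
Hypothesis bgam : forall e, bm (gam e).
Hypothesis gam0 : forall e x, K x -> 0 <= gam e x.
Hypothesis dom_mu : dom_ell K gam mu.

Let w e := pairing K mu (gam e).
Let w0 e : 0 < w e. Proof. by case: dom_mu => _; exact. Qed.
Let f0 x : K x -> 0 < f x.
Proof. by move=> Kx; apply: lt_le_trans c0 (cf Kx). Qed.

Let h x := (f x)^-1 * \sum_e gam e x / w e.

Let u e x := gam e x / w e.

Let u0 e x : K x -> 0 <= u e x.
Proof. by move=> Kx; apply: divr_ge0; [exact: gam0|exact: ltW]. Qed.

Let h0 x : K x -> 0 <= h x.
Proof.
move=> Kx; rewrite mulr_ge0 ?invr_ge0 ?(ltW (f0 Kx))// sumr_ge0// => e _.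
exact: (u0 e Kx).
Qed.

Let fh x : K x -> f x * h x = \sum_e u e x.
Proof. by move=> Kx; rewrite mulVKf// gt_eqF// f0. Qed.

Let u_le e x : K x -> u e x <= f x * h x.
Proof.
move=> Kx; rewrite fh// (bigD1 e)//= lerDl sumr_ge0// => i _; exact: u0.
Qed.

(** The step removes mass only where every [gam e] vanishes, because [0 <= u e x <= f x * h x]. Both
    the positivity of the new pairings and the finiteness of the divergences rest on this. *)
Let h_eq0 e x : K x -> h x = 0 -> gam e x = 0.
Proof.
move=> Kx hx0; have := u_le e Kx; rewrite hx0 mulr0 => ux0.
have /eqP : u e x = 0 by apply/eqP; rewrite eq_le ux0 u0.
by rewrite mulf_eq0 invr_eq0 (gt_eqF (w0 e)) orbF => /eqP.
Qed.

Let bu e : bm (u e).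
Proof. by apply: bounded_measurableM => //; exact: bounded_measurable_cst. Qed.

Let bh : bm h.
Proof.
apply: bounded_measurableM; last exact: bounded_measurable_sum.
split; first by apply: (measurableT_comp (@measurable_inv R)); case: bf.
exists c^-1 => x Kx; rewrite normfV gtr0_norm ?f0// lef_pV2 ?posrE ?f0//.
exact: cf.
Qed.

Let bhlnh : bm (fun x => h x * ln (h x)).
Proof.
have [mh [M hM]] := bh; split.
  by apply: measurable_funM => //; exact: (measurableT_comp (@measurable_ln R)).
exists (1 + M ^+ 2) => x Kx; apply: (le_trans (normr_mul_ln (h0 Kx))).
have hxM := le_trans (ler_norm _) (hM x Kx).
by rewrite lerD2l !expr2 ler_pM ?h0.
Qed.

(** [ln (h x)] is unbounded near the zeros of [h], but [u e <= f * h] bounds the product by the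
    absolute value of [f * (h * ln h)]. *)
Let bulnh e : bm (fun x => u e x * ln (h x)).
Proof.
have [mu_ _] := bu e; have [mh _] := bh.
have [_ [M fhM]] := bounded_measurableM bf bhlnh.
split.
  by apply: measurable_funM => //; exact: (measurableT_comp (@measurable_ln R)).
exists M => x Kx; apply: le_trans (fhM x Kx).
rewrite mulrA [leLHS]normrM [leRHS]normrM ler_wpM2r// ger0_norm ?u0//.
exact: le_trans (u_le e Kx) (ler_norm _).
Qed.

Let dh : is_density K mu h. Proof. exact: bounded_is_density. Qed.

Let mu' := em_step K f gam mu.

Let w' e := pairing K mu' (gam e).

Let w'E e : w' e = \int[mu]_(x in K) (gam e x * h x).
Proof. by apply: pairing_dens => //; case: (bgam e). Qed.

Let w'0 e : 0 < w' e.
Proof.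
(* By [h_eq0], [gam e * h] vanishes only where [gam e] does, and the integral of [gam e] is positive
   since [mu] lies in the domain. *)
rewrite w'E; apply: (@Rintegral_gt0_support _ _ _ _ mu mK (gam e)) => //.
- exact: bounded_measurableM.
- by move=> x Kx; exact: gam0.
- by move=> x Kx; rewrite mulr_ge0 ?gam0 ?h0.
- by move=> x Kx /eqP; rewrite mulf_eq0 => /orP[/eqP//|/eqP]; exact: h_eq0.
- exact: w0.
Qed.

Lemma em_step_dom : dom_ell K gam mu'.
Proof. by split=> [|e]; [exact: dens_concentrated|exact: w'0]. Qed.

Let intu e : \int[mu]_(x in K) u e x = 1.
Proof.
rewrite /u RintegralZr//; last exact: bounded_measurable_integrable.
by rewrite divff// gt_eqF// w0.
Qed.

(** The factor [f] cancels the inverse of [f] in [h], leaving one function [u e] of integral 1 for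
    each index. *)
Lemma pairing_em_step : pairing K mu' f = #|I|%:R.
Proof.
rewrite /mu' /em_step pairing_dens//; last by case: bf.
under eq_Rintegral => x /set_mem Kx do rewrite -/(w _) -/(h x) fh//.
rewrite Rintegral_bounded_measurable_sum//.
under eq_bigr do rewrite intu.
by rewrite sumr_const.
Qed.

(** The density of [nu_ K (gam e) mu'] with respect to [mu], not [mu']; [u e] is the one of
    [nu_ K (gam e) mu]. *)
Let v e x := gam e x / w' e * h x.

Let bv e : bm (v e).
Proof.
apply: bounded_measurableM => //; apply: bounded_measurableM => //.
exact: bounded_measurable_cst.
Qed.

Let v0 e x : K x -> 0 <= v e x.
Proof. by move=> Kx; rewrite mulr_ge0 ?h0// divr_ge0 ?gam0// ltW. Qed.

Let vu e x : K x -> v e x = 0 -> u e x = 0.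
Proof.
move=> Kx /eqP; rewrite mulf_eq0 => /orP[|/eqP hx]; last first.
  by rewrite /u (h_eq0 e Kx hx) mul0r.
by rewrite mulf_eq0 invr_eq0 (gt_eqF (w'0 e)) orbF /u => /eqP ->; rewrite mul0r.
Qed.

Lemma KL_nu_self e : KL (nu_ K (gam e) mu) (nu_ K (gam e) mu) = 0%E.
Proof.
have uE (A : set (borel R p)) : measurable A ->
    nu_ K (gam e) mu A = (\int[mu]_(x in A `&` K) (u e x)%:E)%E.
  move=> mA; apply: (densE (g := u e)).
  exact: bounded_is_density (bu e) (@u0 e).
have [mu_ _] := bu e.
rewrite (KL_common_density_on mK mu_ mu_ (@u0 e) (@u0 e) _ uE uE)//.
rewrite integral0_eq// => x Kx.
have [->|u0'] := eqVneq (u e x) 0; first by rewrite mul0r.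
by rewrite divff// ln1 mulr0.
Qed.

Let KL_nuE e : KL (nu_ K (gam e) mu) (nu_ K (gam e) mu') =
  (\int[mu]_(x in K) (u e x * ln (u e x / v e x))%:E)%E.
Proof.
have [mu_ _] := bu e; have [mv _] := bv e.
apply: KL_common_density_on => //; [exact: u0|exact: v0|exact: vu| |].
- move=> A mA; apply: (densE (g := u e)).
  exact: bounded_is_density (bu e) (@u0 e).
- move=> A mA.
  rewrite [LHS](@densE _ _ _ mu' (fun x => gam e x / w' e)); last first.
    apply: bounded_is_density => //.
      by apply: bounded_measurableM => //; exact: bounded_measurable_cst.
    by move=> x Kx; rewrite divr_ge0 ?gam0// ltW.
  rewrite (@integral_dens _ _ _ mK mu h)//.
  - exact: measurableI.
  - apply/measurable_EFinP; apply: (measurable_funS mK) => //.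
    by apply: measurable_funM => //; case: (bgam e).
Qed.

(** Where [u e x] is nonzero, [gam e x] cancels in the quotient and [u / v = (w' / w) / h];
    elsewhere both sides are [0]. *)
Let uln_uv e x : K x ->
  u e x * ln (u e x / v e x) =
  u e x * (ln (w' e) - ln (w e)) - u e x * ln (h x).
Proof.
move=> Kx; have [->|u0'] := eqVneq (u e x) 0; first by rewrite !mul0r subr0.
have hx : 0 < h x.
  rewrite lt_def h0// andbT; apply: contra_neq u0' => /(h_eq0 e Kx).
  by rewrite /u => ->; rewrite mul0r.
have gx : gam e x != 0.
  by apply: contra_neq u0'; rewrite /u => ->; rewrite mul0r.
rewrite -mulrBr -ln_div ?posrE// -ln_div ?posrE ?divr_gt0//.
congr (_ * ln _); rewrite /u /v.
by field; rewrite gx !gt_eqF// ?w0 ?w'0.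
Qed.

Let g e x := u e x * (ln (w' e) - ln (w e)) - u e x * ln (h x).

Let bg e : bm (g e).
Proof.
apply: bounded_measurableB => //; apply: bounded_measurableM => //.
exact: bounded_measurable_cst.
Qed.

Let KL_nu_int e : KL (nu_ K (gam e) mu) (nu_ K (gam e) mu') =
  (\int[mu]_(x in K) g e x)%:E.
Proof.
rewrite KL_nuE -integral_bounded_measurable//.
by apply: eq_integral => x /set_mem Kx; rewrite uln_uv.
Qed.

Let KL_nu e : KL (nu_ K (gam e) mu) (nu_ K (gam e) mu') =
  (ln (w' e) - ln (w e) - \int[mu]_(x in K) (u e x * ln (h x)))%:E.
Proof.
rewrite KL_nu_int /g RintegralB//; last 2 first.
- apply: bounded_measurable_integrable => //.
  by apply: bounded_measurableM => //; exact: bounded_measurable_cst.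
- exact: bounded_measurable_integrable.
by rewrite RintegralZr ?intu ?mul1r//; exact: bounded_measurable_integrable.
Qed.

Lemma KL_nu_ge0 e : (0 <= KL (nu_ K (gam e) mu) (nu_ K (gam e) mu'))%E.
Proof.
rewrite KL_nu_int lee_fin.
(* Both densities have integral 1, so [0] is rewritten as the integral of [u - v], which [ln_div_ge]
   bounds pointwise by the integrand of the divergence. *)
have <- : \int[mu]_(x in K) (u e x - v e x) = 0.
  rewrite RintegralB//; try exact: bounded_measurable_integrable.
  rewrite intu [X in _ - X](_ : _ = 1) ?subrr//.
  transitivity (\int[mu]_(x in K) ((w' e)^-1 * (gam e x * h x))).
    by apply: eq_Rintegral => x _; rewrite /v mulrAC mulrC.
  rewrite RintegralZl//; last first.
    by apply: bounded_measurable_integrable => //; exact: bounded_measurableM.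
  by rewrite -w'E mulVf// gt_eqF.
apply: le_Rintegral => //; try exact: bounded_measurable_integrable.
  by apply: bounded_measurable_integrable => //; exact: bounded_measurableB.
move=> x Kx; rewrite /g -uln_uv//.
by apply: ln_div_ge; [exact: u0|exact: v0|exact: vu].
Qed.

Lemma em_step_decrease :
  (0 <= Q_ K f gam mu mu - Q_ K f gam mu mu'
     <= ell K f gam mu - ell K f gam mu')%E.
Proof.
have ellE (nu : Mfin) : dom_ell K gam nu ->
    ell K f gam nu = (pairing K nu f - \sum_e ln (pairing K nu (gam e)))%:E.
  by rewrite /ell; case: pselect.
(* The surrogate touches [ell] at the current iterate; the upper bound then only needs that it lies
   above [ell] at [mu']. *)
have -> : Q_ K f gam mu mu = ell K f gam mu.
  by rewrite /Q_ big1 ?adde0// => e _; exact: KL_nu_self.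
apply/andP; split; last first.
  by apply: leeB => //; rewrite /Q_ leeDl// sume_ge0// => e _; exact: KL_nu_ge0.
rewrite /Q_ !ellE//; last exact: em_step_dom.
rewrite (eq_bigr _ (fun e _ => KL_nu e)).
rewrite sumEFin -[in X in (_ - X)%E]EFinD -EFinB lee_fin pairing_em_step !sumrB.
(* After cancellation of the logarithms of [w] and [w'], it remains to bound [#|I|] minus the
   pairing of [mu] with [f] by the sum of the integrals of [u e * ln h]. That pairing is kept as it
   is, since it may differ from [#|I|] at the initial measure. *)
have intf : \int[mu]_(x in K) (f x * h x) = #|I|%:R.
  rewrite -pairing_em_step /mu' /em_step pairing_dens//.
  by case: bf.
have : \int[mu]_(x in K) (f x * h x - f x) <=
    \int[mu]_(x in K) (\sum_e u e x * ln (h x)).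
  have bfh := bounded_measurableM bf bh.
  apply: le_Rintegral => //; try apply: bounded_measurable_integrable => //.
  - exact: bounded_measurableB.
  - exact: bounded_measurable_sum.
  (* As the [u e] add up to [f * h], this is [h - 1 <= h * ln h] multiplied by [f > 0]. *)
  - move=> x Kx; rewrite -mulr_suml -fh// -[X in _ - X]mulr1 -mulrBr -mulrA.
    rewrite ler_pM2l ?f0// -{3}(divr1 (h x)); apply: ln_div_ge; rewrite ?h0//.
    by move=> /eqP; rewrite oner_eq0.
rewrite RintegralB//; try exact: bounded_measurable_integrable; last first.
  by apply: bounded_measurable_integrable => //; exact: bounded_measurableM.
rewrite Rintegral_bounded_measurable_sum// intf.
rewrite /w /w' /pairing; lra.
Qed.

End em_theory.

(** * Continuous functions on a compact set *)

Section continuous_on_compact.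
Context (R : realType) (p : nat) (K : set 'rV[R]_p).
Hypothesis K_compact : compact K.

Lemma compact_measurable_borel : @measurable _ (borel R p) K.
Proof.
rewrite -[K]setCK; apply: measurableC; apply: sub_sigma_algebra.
by apply: closed_openC; apply: compact_closed => //; exact: norm_hausdorff.
Qed.

Lemma continuous_bounded_measurable (g : 'rV[R]_p -> R) :
  {within K, continuous g} -> bounded_measurable (K : set (borel R p)) g.
Proof.
move=> cg; have /continuousP cgP : continuous (g : subspace K -> R) := cg.
split.
  move=> mK; apply: (measurability _ (RGenOpens.measurableE R)) => //.
  move=> _ [_ [a [b ->] <-]].
  have oU : open (g @^-1` `]a, b[%classic : set (subspace K)).
    exact/cgP/interval_open.
  (* A relatively open subset of [K] is the trace of an open set of the whole space, hence Borel. *)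
  have /open_subspaceP[V oV VK] := oU.
  rewrite setIC -VK; apply: measurableI => //; exact: sub_sigma_algebra.
have /compact_bounded[M [_ gM]] := continuous_compact cg K_compact.
(* [compact_bounded] provides every bound strictly above [M], hence the shift by 1. *)
by exists (M + 1) => x Kx; apply: gM; [rewrite ltrDl|exists x].
Qed.

End continuous_on_compact.

(** * Pairing with charges, and positivity of adjoints *)

Section charge_pairing_theory.
Context (R : realType) (p : nat) (K : set 'rV[R]_p).
Hypothesis mK : @measurable _ (borel R p) K.

(** On the negative set [N], the charge [nu] is both nonnegative and nonpositive. *)
Lemma jordan_neg_nonneg (nu : {charge set (borel R p) -> \bar R})
    (P N : set (borel R p)) (nuPN : hahn_decomposition nu P N)
    (A : set (borel R p)) :
  nonneg_charge nu -> measurable A -> jordan_neg nuPN A = 0%E.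
Proof.
move=> nu0 mA; have [_ [mN nN] _ _] := nuPN.
rewrite jordan_negE cjordan_negE /crestr0 mem_set//= /crestr.
have mAN : measurable (A `&` N) by exact: measurableI.
by apply/eqP; rewrite oppe_eq0 eq_le nu0// nN.
Qed.

(** [charge_pairing] relies on a chosen Hahn decomposition; the negative part being null, the
    positive part is a measure with the values of [nu] on Borel sets. *)
Lemma charge_pairing_nonneg (nu : {charge set (borel R p) -> \bar R}) :
  nonneg_charge nu ->
  exists2 m : {measure set (borel R p) -> \bar R},
    forall A : set (borel R p), measurable A -> m A = nu A &
    forall g : 'rV[R]_p -> R, measurable_fun (K : set (borel R p)) g ->
      charge_pairing K nu g = \int[m]_(x in K) g x.
Proof.
move=> nu0; pose D := svalP (cid (svalP (cid (Hahn_decomposition nu)))).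
exists (jordan_pos D) => [A mA|g mg].
  have -> : nu A = (jordan_pos D A + (-1)%:E * jordan_neg D A)%E.
    exact: (jordan_decomp D mA).
  by rewrite jordan_neg_nonneg// mule0 adde0.
rewrite /charge_pairing [X in _ - X](_ : _ = 0) ?subr0//.
rewrite /Rintegral null_set_integral//; first exact/measurable_EFinP.
exact: jordan_neg_nonneg.
Qed.

Lemma charge_pairing_ge0 (nu : {charge set (borel R p) -> \bar R})
    (g : 'rV[R]_p -> R) :
  nonneg_charge nu -> measurable_fun (K : set (borel R p)) g ->
  (forall x, K x -> 0 <= g x) -> 0 <= charge_pairing K nu g.
Proof.
move=> /charge_pairing_nonneg[m _ mE] mg g0; rewrite mE//.
exact: Rintegral_ge0.
Qed.

Lemma charge_pairing_measure (mu : {finite_measure set (borel R p) -> \bar R})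
    (g : 'rV[R]_p -> R) : measurable_fun (K : set (borel R p)) g ->
  charge_pairing K (charge_of_finite_measure mu) g = \int[mu]_(x in K) g x.
Proof.
move=> mg; have nu0 : nonneg_charge (charge_of_finite_measure mu) by [].
have [m mmu ->//] := charge_pairing_nonneg nu0.
by congr fine; apply: eq_measure_integral => A mA _; rewrite mmu.
Qed.

End charge_pairing_theory.

(** The value of [Vadj g] at [x] is its pairing with the Dirac mass at [x], that is, the pairing of
    [g] with the image of this mass by [V], a nonnegative charge. *)
Lemma adjoint_ge0 (R : realType) (p : nat) (K : set 'rV[R]_p)
    (V : MK K -> MK K) (Vadj : CK K -> CK K) (g : CK K) :
  compact K -> nonneg_preserving V -> adjoint_ops V Vadj ->
  (forall x, K x -> 0 <= g x) -> forall x, K x -> 0 <= Vadj g x.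
Proof.
move=> cK V0 Vadj_adj g0 x Kx.
have mK := compact_measurable_borel cK.
have mCK (k : CK K) : measurable_fun (K : set (borel R p)) (k : 'rV[R]_p -> R).
  by have [] := continuous_bounded_measurable cK (@cts_fun _ _ k).
pose dx : {finite_measure set (borel R p) -> \bar R} :=
  @dirac _ (borel R p) x R.
have dxK : concentrated_on K (charge_of_finite_measure dx).
  move=> A mA AK; rewrite /charge_of_finite_measure /= diracE memNset// => Ax.
  by have : (A `&` K) x by []; rewrite AK.
have := Vadj_adj (MkMK dxK) g.
rewrite /pairingMK [RHS]charge_pairing_measure//.
rewrite /Rintegral integral_dirac//; last exact/measurable_EFinP.
rewrite diracE mem_set// mul1e /= => <-.
by apply: charge_pairing_ge0 => //; apply: V0 => A mA; exact: measure_ge0.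
Qed.

(** * The iterates for the operators [W t] *)

Theorem corollary3p3 (R : realType) (p : nat) (K : set 'rV[R]_p)
  (K_compact : compact K)
  (m : nat) (a : 'I_m -> CK K)
  (a_ge0 : forall i x, K x -> 0 <= a i x)
  (W : R -> MK K -> MK K) (Wadj : R -> CK K -> CK K)
  (W_linear : forall t, t \in `[0, 1] -> linear_op (W t))
  (W_continuous : forall t, t \in `[0, 1] -> continuous (W t))
  (W_adjoint : forall t, t \in `[0, 1] -> adjoint_ops (W t) (Wadj t))
  (W_nonneg : forall t, t \in `[0, 1] -> nonneg_preserving (W t))
  (leb : {sigma_finite_measure set (borel R p) -> \bar R})
  (leb_lebesgue : is_lebesgue leb)
  (W_integrable :
    (@lebesgue_measure R \x leb)%E.-integrable (`[0, 1] `*` K)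
      (fun tx => (Wadj tx.1 (one_CK K) tx.2)%:E))
  (f_defined : forall x, K x ->
    (@lebesgue_measure R).-integrable `[0, 1]
      (fun t => (Wadj t (Aadj a (fun=> 1)) x)%:E))
  (f_continuous : {within K, continuous (sensitivity a Wadj)})
  (f_positive : exists2 c : R, 0 < c &
    forall x, K x -> c <= sensitivity a Wadj x)
  (nd : 'I_m -> nat) (td : forall i, 'I_(nd i) -> R)
  (td01 : forall i j, td i j \in `[0, 1])
  (mu0 : {finite_measure set (borel R p) -> \bar R}) :
  let f := sensitivity a Wadj in
  let gam := fun e : detection nd => (Gamma a Wadj td e : 'rV[R]_p -> R) in
  let n := (\sum_(i < m) nd i)%N in
  let mu := em_iter K f gam mu0 in
  let X := fun k => X_ K f gam n (mu k) in
  let Q := fun k => Q_ K f gam (mu k) in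
  mu0 \in dom_ell K gam ->
  forall k : nat,
    [/\ X k (mu k.+1), (0 < k)%N -> X k (mu k) &
        (0 <= Q k (mu k) - Q k (mu k.+1)
           <= ell K f gam (mu k) - ell K f gam (mu k.+1))%E].
Proof.
move=> f gam n mu X Q /set_mem dom0 k.
have mK := compact_measurable_borel K_compact.
have bf := continuous_bounded_measurable K_compact f_continuous.
have bgam e := continuous_bounded_measurable K_compact
  (@cts_fun _ _ (Gamma a Wadj td e)).
have gam0 e x : K x -> 0 <= gam e x.
  have te := td01 (tag e) (tagged e).
  apply: (adjoint_ge0 K_compact (W_nonneg _ te) (W_adjoint _ te)).
  exact: a_ge0.
have [c c0 cf] := f_positive.
have nE : #|{: detection nd}| = n.
  rewrite card_tagged sumnE big_map big_enum.
  by apply: eq_bigr => i _; rewrite card_ord.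
have dom : forall j, dom_ell K gam (mu j).
  elim=> [//|j ih]; exact: (em_step_dom mK bf c0 cf bgam gam0 ih).
(* Only from index 1 on: the initial measure may have another pairing with [f], whence the condition
   [0 < k] in the conclusion. *)
have muf j : pairing K (mu j.+1) f = n%:R.
  by rewrite -nE; exact: (pairing_em_step mK bf c0 cf bgam gam0 (dom j)).
have dec j : mu j.+1 `<< mu j by exact: dens_dominates.
split.
(* [mu k.+1] is [em_step] of [mu k] by computation, so one domination is reflexive and the other is
   [dec]; for [mu k] itself the roles are exchanged. *)
- by split; [case: (dom k.+1)|move=> A|exact: dec|exact: muf].
- case: k => // k _.
  by split; [case: (dom k.+1)|exact: dec|move=> A|exact: muf].
- exact: (em_step_decrease mK bf c0 cf bgam gam0 (dom k)).
Qed.
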